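(* Let $L\ge1$ and $M>K\ge 1$ be integers, let $\beta_{jkn}>0$ ($1\le j,n\le L$, $1\le k\le K$) be large scale fading coefficients, and let $p_{kn}>0$ and $q_{kn}>0$ be the training and transmit powers. Put $\boldsymbol\beta_{kn}=(\beta_{1kn},\ldots,\beta_{Lkn})^T$ and $\boldsymbol\Lambda_k=\mathrm{diag}(\lambda_{1k},\ldots,\lambda_{Lk})$ with $$\lambda_{jk}=\frac{M}{M-K}\Bigl(1+\sum_{i=1}^L\beta_{jki}p_{ki}\Bigr)\Bigl(1+\sum_{n=1}^L\sum_{m=1}^K\Bigl[\beta_{jmn}-\frac{\beta_{jmn}^2p_{mn}}{1+\sum_{i=1}^L\beta_{jmi}p_{mi}}\Bigr]q_{mn}\Bigr).$$ If zero-forcing is used as the $M$-dimensional decoding in Large Scale Fading Decoding (LSFD), then for every user $k$ in every cell $l$, the (normalized) LSFD coefficient vector $$\hat{\mathbf a}_{kl,\mathrm{opt}}=\Bigl(\sum_{n=1,\,n\ne l}^L\boldsymbol\beta_{kn}\boldsymbol\beta_{kn}^{\mathsf H}p_{kn}q_{kn}M+\boldsymbol\Lambda_k\Bigr)^{-1}\boldsymbol\beta_{kl}$$ is optimal, i.e. it maximizes $\mathrm{SINR}_{kl}(\hat{\mathbf a}_{kl})$ over all nonzero $\hat{\mathbf a}_{kl}\in\mathbb C^L$, and the corresponding achievable SINR is $$\mathrm{SINR}_{kl,\mathrm{opt}}=\boldsymbol\beta_{kl}^{\mathsf H}\Bigl(\sum_{n=1,\,n\ne l}^L\boldsymbol\beta_{kn}\boldsymbol\beta_{kn}^{\mathsf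 H}p_{kn}q_{kn}M+\boldsymbol\Lambda_k\Bigr)^{-1}\boldsymbol\beta_{kl}\;p_{kl}q_{kl}M.$$
   Context: There are $L$ cells, each with a base station having $M$ antennas and $K$ single-antenna users. $\beta_{jkn}$ is the large scale fading coefficient between user $k$ of cell $n$ and base station $j$; $p_{kn}$ is the training power and $q_{kn}$ the data transmit power of user $k$ of cell $n$. In LSFD, base station $j$ produces a first-stage estimate $\tilde s_{kj}$ of the uplink signal of its user $k$ (here by zero-forcing based on the MMSE channel estimates), and a controller forms $\hat s_{kl}=\sum_{j=1}^La_{klj}^*\tilde s_{kj}$ with $a_{klj}\in\mathbb C$. Write $\hat a_{klj}=a_{klj}/(\beta_{jkj}\sqrt{p_{kj}})$ and $\hat{\mathbf a}_{kl}=(\hat a_{kl1},\ldots,\hat a_{klL})^T$. With zero-forcing, the achievable SINR of user $k$ in cell $l$ as a function of $\hat{\mathbf a}_{kl}\ne\mathbf 0$ is $$\mathrm{SINR}_{kl}(\hat{\mathbf a}_{kl})=\frac{\bigl|\sum_{j=1}^L\hat a_{klj}^*\beta_{jkl}\bigr|^2p_{kl}q_{kl}}{\displaystyle\sum_{n=1,\,n\neq l}^L\Bigl|\sum_{j=1}^L\hat a_{klj}^*\beta_{jkn}\Bigr|^2p_{kn}q_{kn}+\sum_{j=1}^L\frac{|\hat a_{klj}|^2}{M-K}\Bigl(1+\sum_{i=1}^L\beta_{jki}p_{ki}\Bigr)\Bigl(1+\sum_{n=1}^L\sum_{m=1}^K\Bigl[\beta_{jmn}-\frac{\beta_{jmn}^2p_{mn}}{1+\sum_{i=1}^L\beta_{jmi}p_{mi}}\Bigr]q_{mn}\Bigr)}.$$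 $(\cdot)^{\mathsf H}$ denotes Hermitian transpose and $(\cdot)^*$ complex conjugation. *)

(* Defs.v *)
From mathcomp Require Import all_boot all_order all_algebra.
From mathcomp Require Import complex reals.

Set Implicit Arguments.
Unset Strict Implicit.
Unset Printing Implicit Defensive.

Import Order.TTheory GRing.Theory Num.Theory.

(* ring_scope is opened last, so that [z^*] is [Num.conj]. *)
Local Open Scope sesquilinear_scope.
Local Open Scope complex_scope.
Local Open Scope ring_scope.

Section LSFD.

(* [beta j k n] is the fading coefficient between user k of cell n and base
   station j; [p k n] and [q k n] are the training and data powers of user k of
   cell n. *)
Variables (R : realType) (L K : nat) (M : nat).
Variables (beta : 'I_L -> 'I_K -> 'I_L -> R) (p q : 'I_K -> 'I_L -> R).

Definition pilot_power (j : 'I_L) (k : 'I_K) : R :=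
  1 + \sum_(i < L) beta j k i * p k i.

(* [beta^2 p / pilot_power] is the variance of the MMSE channel estimate, so
   the bracket is the variance of the estimation error. *)
Definition residual_power (j : 'I_L) : R :=
  1 + \sum_(n < L) \sum_(m < K)
        (beta j m n - beta j m n ^+ 2 * p m n / pilot_power j m) * q m n.

(* SINR as a function of the normalized coefficients
   [a_j = a_klj / (beta_jkj sqrt p_kj)].  When all fadings and powers are
   positive and K < M, the denominator is positive for every nonzero [a]. *)
Definition sinr_zf (k : 'I_K) (l : 'I_L) (a : 'cV[R[i]]_L) : R :=
  Normc.normc (\sum_(j < L) (a j 0)^* * (beta j k l)%:C) ^+ 2 * p k l * q k l
  / (\sum_(n < L | n != l)
       Normc.normc (\sum_(j < L) (a j 0)^* * (beta j k n)%:C) ^+ 2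
       * p k n * q k n
     + \sum_(j < L) Normc.normc (a j 0) ^+ 2 / (M%:R - K%:R)
                    * pilot_power j k * residual_power j).

Definition lambda (j : 'I_L) (k : 'I_K) : R :=
  M%:R / (M%:R - K%:R) * pilot_power j k * residual_power j.

Definition beta_vec (k : 'I_K) (n : 'I_L) : 'cV[R[i]]_L :=
  \col_j (beta j k n)%:C.

Definition Lambda_mx (k : 'I_K) : 'M[R[i]]_L :=
  diag_mx (\row_j (lambda j k)%:C).

Definition lsfd_mx (k : 'I_K) (l : 'I_L) : 'M[R[i]]_L :=
  \sum_(n < L | n != l)
     (p k n * q k n * M%:R)%:C *: (beta_vec k n *m (beta_vec k n)^t*)
  + Lambda_mx k.

Definition lsfd_opt (k : 'I_K) (l : 'I_L) : 'cV[R[i]]_L :=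
  invmx (lsfd_mx k l) *m beta_vec k l.

End LSFD.

(* Main.v *)
(** With [B] the matrix inverted in the optimal coefficients and [b] the vector
    [beta_kl], the SINR of [a] equals [p q M |a^H b|^2 / (a^H B a)], and [B] is
    Hermitian positive definite because every [lambda_jk] is positive.  Writing
    [b = B x], Cauchy-Schwarz for the scalar product defined by [B] bounds
    [|a^H b|^2 = |a^H B x|^2] by [(a^H B a) (x^H B x)], with equality at
    [a = x], and [x^H B x = b^H B^-1 b]. *)

Require Import Defs.
From mathcomp Require Import all_boot all_order all_algebra.
From mathcomp Require Import complex reals ring.
Import Order.TTheory GRing.Theory Num.Theory.
Local Open Scope sesquilinear_scope.
Local Open Scope complex_scope.
Local Open Scope ring_scope.

Set Implicit Arguments.
Unset Strict Implicit.

Lemma adjmx_mul (C : numClosedFieldType) m n p (A : 'M[C]_(m, n))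
  (B : 'M[C]_(n, p)) : (A *m B)^t* = B^t* *m A^t*.
Proof. by rewrite trmx_mul map_mxM. Qed.

Lemma adjmxE (C : numClosedFieldType) m n (A : 'M[C]_(m, n)) i j :
  (A^t*) i j = (A j i)^*.
Proof. by rewrite !mxE. Qed.

(** * Hermitian positive definite forms and their Rayleigh quotient *)

Section HermitianPositiveDefinite.
Variables (C : numClosedFieldType) (n : nat) (B : 'M[C]_n).

Definition herm_form (u v : 'cV[C]_n) : C := (u^t* *m B *m v) 0 0.

Lemma herm_formBr u v w : herm_form u (v - w) = herm_form u v - herm_form u w.
Proof. by rewrite /herm_form mulmxBr !mxE. Qed.

Lemma herm_formZr c u v : herm_form u (c *: v) = c * herm_form u v.
Proof. by rewrite /herm_form -scalemxAr mxE. Qed.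

Hypothesis B_herm : B^t* = B.

Lemma herm_form_conj u v : (herm_form u v)^* = herm_form v u.
Proof. by rewrite -adjmxE !adjmx_mul trmxCK B_herm mulmxA. Qed.

Lemma herm_formBl u v w : herm_form (u - v) w = herm_form u w - herm_form v w.
Proof. by rewrite -!(herm_form_conj w) herm_formBr rmorphB. Qed.

Lemma herm_formZl c u v : herm_form (c *: u) v = c^* * herm_form u v.
Proof. by rewrite -!(herm_form_conj v) herm_formZr rmorphM. Qed.

Hypothesis B_pos : forall a : 'cV[C]_n, a != 0 -> 0 < herm_form a a.

(** A nonzero row [v] with [v *m B = 0] would make the form vanish at the nonzero column [v^t*]. *)
Lemma posdef_unitmx : B \in unitmx.
Proof.
rewrite -row_free_unit -kermx_eq0; apply/negPn/negP => /rowV0Pn[v].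
move=> /sub_kermxP vB0 v_neq0.
have := @B_pos (v^t*).
rewrite /herm_form trmxCK vB0 mul0mx mxE ltxx => /(_ _)/negP; apply => //.
apply: contra v_neq0 => /eqP/(congr1 (fun w => w^t*)).
by rewrite trmxCK trmx0 map_mx0 => ->.
Qed.

Lemma herm_form_CauchySchwarz a x :
  `|herm_form a x| ^+ 2 <= herm_form a a * herm_form x x.
Proof.
have [->|x_neq0] := eqVneq x 0.
  by rewrite /herm_form !mulmx0 mxE normr0 expr0n mulr0.
have s_gt0 := B_pos x_neq0.
have sE : (herm_form x x)^* = herm_form x x by rewrite herm_form_conj.
(* Up to the factor [herm_form x x], [y] is the component of [a] orthogonal to [x]; scaling avoids a
   division. *)
pose y := herm_form x x *: a - herm_form x a *: x.
have : 0 <= herm_form y y.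
  have [->|y_neq0] := eqVneq y 0; first by rewrite /herm_form mulmx0 mxE.
  exact/ltW/B_pos.
have -> : herm_form y y
    = herm_form x x * (herm_form a a * herm_form x x - `|herm_form a x| ^+ 2).
  rewrite !(herm_formBl, herm_formBr, herm_formZl, herm_formZr).
  by rewrite sE normCK !herm_form_conj; ring.
by rewrite pmulr_rge0 // subr_ge0.
Qed.

Lemma herm_form_invr a b : herm_form a (invmx B *m b) = (a^t* *m b) 0 0.
Proof. by rewrite /herm_form -mulmxA mulKVmx ?posdef_unitmx. Qed.

Lemma herm_form_inv b :
  herm_form (invmx B *m b) (invmx B *m b) = (b^t* *m invmx B *m b) 0 0.
Proof.
by rewrite -herm_form_conj herm_form_invr -adjmxE adjmx_mul trmxCK mulmxA.
Qed.

Lemma rayleigh_quotient_le (a b : 'cV[C]_n) : a != 0 ->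
  `|(a^t* *m b) 0 0| ^+ 2 / herm_form a a <= (b^t* *m invmx B *m b) 0 0.
Proof.
move=> a_neq0; rewrite ler_pdivrMr ?B_pos // mulrC.
by rewrite -herm_form_inv -herm_form_invr herm_form_CauchySchwarz.
Qed.

Lemma invmx_mul_neq0 (b : 'cV[C]_n) : b != 0 -> invmx B *m b != 0.
Proof.
apply: contra => /eqP x0.
by rewrite -(mulKVmx posdef_unitmx b) x0 mulmx0.
Qed.

Lemma rayleigh_quotient_opt (b : 'cV[C]_n) : b != 0 ->
  `|((invmx B *m b)^t* *m b) 0 0| ^+ 2 / herm_form (invmx B *m b) (invmx B *m b)
  = (b^t* *m invmx B *m b) 0 0.
Proof.
move=> /invmx_mul_neq0/B_pos s_gt0.
(* At the optimum the numerator is the square of the denominator, which is a positive real. *)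
rewrite -herm_form_invr ger0_norm ?ltW // -herm_form_inv.
by rewrite expr2 mulfK // gt_eqF.
Qed.
End HermitianPositiveDefinite.

(** The form factors as [a^t* *m v] times [v^t* *m a], and the second scalar is the conjugate of the
    first. *)
Lemma herm_form_rank1 (C : numClosedFieldType) n (v a : 'cV[C]_n) :
  herm_form (v *m v^t*) a a = `|(a^t* *m v) 0 0| ^+ 2.
Proof.
rewrite /herm_form mulmxA -mulmxA mxE big_ord1 normCK -adjmxE adjmx_mul.
by rewrite trmxCK.
Qed.

Lemma herm_form_diag (C : numClosedFieldType) n (d : 'rV[C]_n) (a : 'cV[C]_n) :
  herm_form (diag_mx d) a a = \sum_j d 0 j * `|a j 0| ^+ 2.
Proof.
rewrite /herm_form mul_mx_diag mxE; apply: eq_bigr => j _.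
by rewrite !mxE normCKC mulrAC mulrC.
Qed.

Lemma conjC_real (R : rcfType) (x : R) : (x%:C)^* = x%:C.
Proof. exact: conjc_real. Qed.

(** * The zero-forcing SINR as a Rayleigh quotient *)

Section ZeroForcing.
Variables (R : realType) (L K M : nat).
Variables (beta : 'I_L -> 'I_K -> 'I_L -> R) (p q : 'I_K -> 'I_L -> R).
Hypothesis K_ltM : (K < M)%N.
Hypothesis beta_gt0 : forall j k n, 0 < beta j k n.
Hypothesis p_gt0 : forall k n, 0 < p k n.
Hypothesis q_gt0 : forall k n, 0 < q k n.

Lemma natrB_gt0 : 0 < M%:R - K%:R :> R.
Proof. by rewrite subr_gt0 ltr_nat. Qed.

Lemma pilot_power_gt0 j k : 0 < pilot_power beta p j k.
Proof.
by rewrite ltr_pwDl // sumr_ge0 // => i _; rewrite mulr_ge0 // ltW.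
Qed.

Lemma residual_power_gt0 j : 0 < residual_power beta p q j.
Proof.
rewrite ltr_pwDl // sumr_ge0 // => n _; rewrite sumr_ge0 // => m _.
rewrite mulr_ge0 ?(ltW (q_gt0 _ _)) // subr_ge0 ler_pdivrMr ?pilot_power_gt0 //.
(* [beta j m n * p m n] is one of the summands of [pilot_power], so the error variance is
   nonnegative. *)
rewrite expr2 -mulrA ler_pM2l // /pilot_power (bigD1 n) //= addrCA lerDl.
by rewrite addr_ge0 // sumr_ge0 // => i _; rewrite mulr_ge0 // ltW.
Qed.

Lemma lambda_gt0 j k : 0 < lambda M beta p q j k.
Proof.
rewrite !mulr_gt0 ?invr_gt0 ?natrB_gt0 ?pilot_power_gt0 ?residual_power_gt0 //.
by rewrite ltr0n (leq_ltn_trans _ K_ltM).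
Qed.

Variables (k : 'I_K) (l : 'I_L).
Local Notation B := (lsfd_mx M beta p q k l).
Local Notation b := (beta_vec beta k l).

Lemma lsfd_mx_herm : B^t* = B.
Proof.
apply/matrixP => i j; rewrite adjmxE !mxE !summxE rmorphD rmorph_sum /=.
congr (_ + _).
  apply: eq_bigr => n _; rewrite !mxE !big_ord1 !mxE !rmorphM /=.
  by rewrite !conjC_real; ring.
by rewrite rmorphMn /= conjC_real eq_sym; case: eqP => [->|].
Qed.

Lemma lsfd_formE a : herm_form B a a =
  \sum_(n < L | n != l)
    (p k n * q k n * M%:R)%:C * `|(a^t* *m beta_vec beta k n) 0 0| ^+ 2
  + \sum_j (lambda M beta p q j k)%:C * `|a j 0| ^+ 2.
Proof.
rewrite /herm_form /lsfd_mx mulmxDr mulmx_sumr mulmxDl mulmx_suml mxE summxE.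
congr (_ + _); last first.
  rewrite -/(herm_form _ a a) herm_form_diag.
  by apply: eq_bigr => j _; rewrite mxE.
apply: eq_bigr => n _.
by rewrite -scalemxAr -scalemxAl mxE -/(herm_form _ a a) herm_form_rank1.
Qed.

(** The interference part is only nonnegative; strictness comes from the diagonal part, at an index
    where [a] does not vanish. *)
Lemma lsfd_form_gt0 (a : 'cV[R[i]]_L) : a != 0 -> 0 < herm_form B a a.
Proof.
move=> a_neq0; rewrite lsfd_formE ltr_wpDl //.
  apply: sumr_ge0 => n _; rewrite mulr_ge0 ?exprn_ge0 // lecR.
  by rewrite !mulr_ge0 ?ler0n // ltW.
have [j aj_neq0] : exists j, a j 0 != 0.
  apply/existsP; apply: contraNT a_neq0; rewrite negb_exists => /forallP a0.
  by apply/eqP/colP => j; rewrite mxE; apply/eqP/negPn.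
have l_gt0 i : 0 < (lambda M beta p q i k)%:C by rewrite ltcR lambda_gt0.
rewrite (bigD1 j) //= ltr_pwDl ?sumr_ge0 // => [|i _].
  by rewrite mulr_gt0 ?exprn_gt0 ?normr_gt0.
by rewrite mulr_ge0 ?exprn_ge0 // ltW.
Qed.

(** Repeats the denominator of [sinr_zf] verbatim, so that it can be folded there. *)
Definition sinr_den (a : 'cV[R[i]]_L) : R :=
  \sum_(n < L | n != l)
    Normc.normc (\sum_(j < L) (a j 0)^* * (beta j k n)%:C) ^+ 2
    * p k n * q k n
  + \sum_(j < L) Normc.normc (a j 0) ^+ 2 / (M%:R - K%:R)
                 * pilot_power beta p j k * residual_power beta p q j.

Lemma norm_mul_beta_vec (a : 'cV[R[i]]_L) n :
  `|(a^t* *m beta_vec beta k n) 0 0|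
  = (Normc.normc (\sum_(j < L) (a j 0)^* * (beta j k n)%:C))%:C.
Proof.
by rewrite mxE; congr `|_|; apply: eq_bigr => j _; rewrite !mxE.
Qed.

(** Both the interference weights in [B] and every [lambda] carry the factor [M], which comes out in
    front. *)
Lemma lsfd_form_sinr_den a : herm_form B a a = (M%:R * sinr_den a)%:C.
Proof.
rewrite lsfd_formE mulrDr rmorphD /= !mulr_sumr !rmorph_sum /=.
congr (_ + _); apply: eq_bigr => n _.
  by rewrite norm_mul_beta_vec -rmorphXn -!rmorphM /=; congr (_%:C); ring.
(* The norm of [R[i]] is by conversion the embedded real modulus. *)
rewrite -[`|a n 0|]/((Normc.normc (a n 0))%:C) -rmorphXn -!rmorphM /=.
by congr (_%:C); rewrite /lambda; ring.
Qed.

Lemma sinr_zfE a : (sinr_zf M beta p q k l a)%:C =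
  `|(a^t* *m b) 0 0| ^+ 2 / herm_form B a a * (p k l * q k l * M%:R)%:C.
Proof.
rewrite norm_mul_beta_vec lsfd_form_sinr_den -!rmorphXn -fmorphV -!rmorphM /=.
congr (_%:C); rewrite /sinr_zf -/(sinr_den a) invfM.
have M_neq0 : M%:R != 0 :> R by rewrite pnatr_eq0 -lt0n (leq_ltn_trans _ K_ltM).
(* With the inverse generalized, [field] only asks for [M] to be nonzero, so the identity also
   covers [a = 0]. *)
by move: (sinr_den a)^-1 => d; field.
Qed.

End ZeroForcing.

Theorem theorem5 (R : realType) (L K M : nat)
    (beta : 'I_L -> 'I_K -> 'I_L -> R) (p q : 'I_K -> 'I_L -> R)
    (L_ge1 : (1 <= L)%N) (K_ge1 : (1 <= K)%N) (K_ltM : (K < M)%N)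
    (beta_gt0 : forall j k n, 0 < beta j k n)
    (p_gt0 : forall k n, 0 < p k n) (q_gt0 : forall k n, 0 < q k n)
    (k : 'I_K) (l : 'I_L) :
  [/\ lsfd_mx M beta p q k l \in unitmx,
      lsfd_opt M beta p q k l != 0,
      forall a : 'cV[R[i]]_L, a != 0 ->
        sinr_zf M beta p q k l a
        <= sinr_zf M beta p q k l (lsfd_opt M beta p q k l)
    & (sinr_zf M beta p q k l (lsfd_opt M beta p q k l))%:C
      = ((beta_vec beta k l)^t* *m invmx (lsfd_mx M beta p q k l)
         *m beta_vec beta k l) 0 0
        * (p k l)%:C * (q k l)%:C * M%:R].
Proof.
have B_herm := lsfd_mx_herm M beta p q k l.
have B_pos := @lsfd_form_gt0 _ _ _ _ _ _ _ K_ltM beta_gt0 p_gt0 q_gt0 k l.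
have b_neq0 : beta_vec beta k l != 0.
  (* Entry [l] would give [beta l k l = 0] on real parts. *)
  apply/eqP => /matrixP/(_ l 0); rewrite !mxE => -[] /eqP.
  by rewrite gt_eqF.
have sinrE := sinr_zfE beta p q K_ltM.
split.
- exact: posdef_unitmx B_pos.
- exact: (invmx_mul_neq0 B_pos b_neq0).
(* In [R[i]] both sides are Rayleigh quotients times the same nonnegative factor. *)
- move=> a a_neq0; rewrite -lecR !sinrE.
  rewrite [in leRHS]rayleigh_quotient_opt // ler_wpM2r //.
    by rewrite lecR !mulr_ge0 ?ler0n // ltW.
  exact: rayleigh_quotient_le.
- by rewrite sinrE rayleigh_quotient_opt // !rmorphM /= rmorph_nat !mulrA.
Qed.
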